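(* Let $\mathcal{H}$ be a separable Hilbert space with inner product $\langle\cdot,\cdot\rangle$ and norm $\|\cdot\|$, let $\mathcal{A}$ be a self-adjoint operator on $\mathcal{H}$, and let $\mathcal{B}$ be a self-adjoint, strictly positive operator on $\mathcal{H}$ with bounded inverse. Let $\mathcal{H}_{\mathcal{B}}$ and $\mathcal{L}$ be as in the context, under the standing assumptions stated there. Suppose that at least one of the following holds: (C1) there exist constants $a,b>0$ such that $\|\mathcal{B}^{-1/2}\mathcal{A}f\|\leq a\|f\|+b\|\mathcal{B}^{1/2}f\|$ for all $f\in\mathcal{D}(\mathcal{A})\cap\mathcal{D}(\mathcal{B}^{1/2})$; (C2) $\mathcal{D}(\mathcal{B})\subset\mathcal{D}(\mathcal{A})$ and there exist constants $a,b>0$ such that $\|\mathcal{A}f\|\leq a\|f\|+b\|\mathcal{B}f\|$ for all $f\in\mathcal{D}(\mathcal{B})$; (C3) the spectrum of $\mathcal{A}$ is not all of $\mathbb{R}$, $\mathcal{D}(\mathcal{A})\subset\mathcal{D}(\mathcal{B})$, and there exist constants $a,b>0$ such that $\|\mathcal{B}f\|\leq a\|f\|+b\|\mathcal{A}f\|$ for all $f\in\mathcal{D}(\mathcal{A})$. Then $\mathcal{L}$ is self-adjoint on $\mathcal{H}_{\mathcal{B}}$. Moreover, if (C1) holds, then $\mathcal{L}$ is bounded on $\mathcal{H}_{\mathcal{B}}$.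
   Context: $\mathcal{H}_{\mathcal{B}}$ denotes $\mathcal{D}(\mathcal{B}^{1/2})$ equipped with the inner product $\langle f,g\rangle_{\mathcal{B}}=\langle \mathcal{B}^{1/2}f,\mathcal{B}^{1/2}g\rangle$ and norm $\|f\|_{\mathcal{B}}=\|\mathcal{B}^{1/2}f\|$; it is a Hilbert space. $\mathcal{H}_{\mathcal{B}^{-1}}$ denotes the completion of $\mathcal{H}$ with respect to the inner product $\langle f,g\rangle_{\mathcal{B}^{-1}}=\langle \mathcal{B}^{-1/2}f,\mathcal{B}^{-1/2}g\rangle$. Standing assumptions: (i) $\mathcal{D}(\mathcal{A})\cap\mathcal{D}(\mathcal{B}^{1/2})$ is dense in $\mathcal{H}_{\mathcal{B}}$; (ii) the operator $\mathcal{A}$ restricted to $\mathcal{D}(\mathcal{A})\cap\mathcal{D}(\mathcal{B}^{1/2})$, viewed as an operator from $\mathcal{H}_{\mathcal{B}}$ to $\mathcal{H}_{\mathcal{B}^{-1}}$, is closable. The operator $\mathcal{B}^{-1}\mathcal{A}$ with domain $\mathcal{D}(\mathcal{A})\cap\mathcal{D}(\mathcal{B}^{1/2})$ is symmetric in $\mathcal{H}_{\mathcal{B}}$, hence closable, and $\mathcal{L}$ denotes its closure in $\mathcal{H}_{\mathcal{B}}$: $\mathcal{L}=\overline{\mathcal{B}^{-1}\mathcal{A}|_{\mathcal{D}(\mathcal{A})\cap\mathcal{D}(\mathcal{B}^{1/2})}}$. *)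

(* Defs.v *)
(* abstract complex Hilbert space over C := R[i], R : realType. *)
From mathcomp Require Import all_boot all_algebra.
From mathcomp Require Export reals complex.
Set Implicit Arguments. Unset Strict Implicit. Unset Printing Implicit Defensive.
Import GRing.Theory Num.Theory.
Local Open Scope ring_scope.

Section Hilbert.
Variables (R : realType) (V : lmodType R[i]).

(* inner product: linear in the first argument, conjugate symmetric,
   positive definite *)
Definition is_inner_product (ip : V -> V -> R[i]) : Prop :=
  [/\ (forall (a : R[i]) x y z, ip (a *: x + y) z = a * ip x z + ip y z),
      (forall x y, ip x y = (ip y x)^*),
      (forall x, 0 <= ip x x) &
      (forall x, ip x x = 0 -> x = 0)].

(* the norm induced by a (semi-)inner product q *)
Definition qnorm (q : V -> V -> R[i]) (x : V) : R :=
  Num.sqrt (complex.Re (q x x)).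

Definition is_complete (ip : V -> V -> R[i]) : Prop :=
  forall u : nat -> V,
    (forall e : R, 0 < e -> exists N, forall m n, (N <= m)%N -> (N <= n)%N ->
        qnorm ip (u m - u n) < e) ->
    exists l : V, forall e : R, 0 < e -> exists N, forall n, (N <= n)%N ->
        qnorm ip (u n - l) < e.

Definition is_separable (ip : V -> V -> R[i]) : Prop :=
  exists d : nat -> V, forall x (e : R), 0 < e -> exists n, qnorm ip (x - d n) < e.

(* Operators are handled through their graphs (relations V -> V -> Prop).
   A Hilbert space is given as a carrier predicate X on V with inner
   product q (X = everything, q = ip for H; X = D(B^{1/2}),
   q f g = ip (B^{1/2} f) (B^{1/2} g) for H_B). *)

(* graph of the operator with domain D acting as T on D *)
Definition graph (D : V -> Prop) (T : V -> V) : V -> V -> Prop :=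
  fun f g => D f /\ g = T f.

Definition single_valued (G : V -> V -> Prop) : Prop :=
  forall f g g', G f g -> G f g' -> g = g'.

(* closure of the graph G in the space (X, q) *)
Definition rel_closure (X : V -> Prop) (q : V -> V -> R[i])
  (G : V -> V -> Prop) : V -> V -> Prop :=
  fun f g => X f /\ X g /\
    forall e : R, 0 < e -> exists f' g', G f' g' /\
        qnorm q (f - f') < e /\ qnorm q (g - g') < e.

(* adjoint (as a relation) of G in the space (X, q) *)
Definition rel_adjoint (X : V -> Prop) (q : V -> V -> R[i])
  (G : V -> V -> Prop) : V -> V -> Prop :=
  fun h k => X h /\ X k /\ forall f g, G f g -> q g h = q f k.

(* G is (the graph of) a self-adjoint operator in (X, q) *)
Definition self_adjoint (X : V -> Prop) (q : V -> V -> R[i])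
  (G : V -> V -> Prop) : Prop :=
  single_valued G /\ forall f g, G f g <-> rel_adjoint X q G f g.

(* G is (the graph of) an everywhere defined bounded operator on (X, q) *)
Definition bounded_everywhere (X : V -> Prop) (q : V -> V -> R[i])
  (G : V -> V -> Prop) : Prop :=
  (forall f, X f -> exists g, G f g) /\
  exists c : R, forall f g, G f g -> qnorm q g <= c * qnorm q f.

End Hilbert.

(* Main.v *)
(** Let M be the operator [B^(-1/2) A B^(-1/2)], unitarily equivalent to [B^(-1) A] on
    the energy space. A pair (h, k) lies in the adjoint of [B^(-1) A] iff
    [<A f, h> = <S f, S k>] for all f in the core, S being the square root of B.

    Bounds pass from H to the energy space by Lax's lemma: an operator bounded for
    a norm and symmetric for a weaker inner product is bounded for the weaker norm.
    Under (C2) it applies to [A B^(-1)] and makes M bounded on a dense subspace,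
    as (C1) does directly; under (C3) it applies to [B (A - lam)^(-1)] and makes
    [S (A - lam)^(-1) S] bounded, which is the inverse of M up to the bounded
    perturbation [lam B^(-1)]. In each case, testing against a dense subspace
    turns the weak relation between h and k into norm estimates which exhibit
    (h, k) as a limit of pairs (f, B^(-1) A f), so the adjoint is contained in
    the closure. *)
Require Import Defs.
From mathcomp Require Import all_boot all_order all_algebra.
From mathcomp Require Import boolp classical_sets reals complex lra.
Set Implicit Arguments. Unset Strict Implicit.
Import Order.TTheory GRing.Theory Num.Theory.
Local Open Scope ring_scope.

(** * Real inequalities: vanishing error terms and log-convex sequences *)

Lemma ler_of_eps (R : realType) (a b c : R) :
  (forall e, 0 < e -> a <= b + e * c) -> a <= b.
Proof.
move=> H; rewrite leNgt; apply/negP => lt_ba.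
have c1 : 0 < `|c| + 1 by have := normr_ge0 c; lra.
(* The sign of [c] is arbitrary; dividing by [|c| + 1] keeps [e * c] below half the gap [a - b]. *)
have e0 : 0 < (a - b) / (`|c| + 1) / 2 by rewrite !divr_gt0 // subr_gt0.
have := H _ e0.
have : (a - b) / (`|c| + 1) / 2 * c <= (a - b) / (`|c| + 1) / 2 * (`|c| + 1).
  by apply: ler_wpM2l; [exact: ltW | have := ler_norm c; lra].
have -> : (a - b) / (`|c| + 1) / 2 * (`|c| + 1) = (a - b) / 2.
  by rewrite mulrAC divfK // gt_eqF.
lra.
Qed.

Lemma archi_inv (R : realType) (e : R) : 0 < e ->
  exists k : nat, forall n, (k <= n)%N -> n.+1%:R^-1 < e.
Proof.
move=> e0; exists (Num.truncn e^-1) => n kn.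
rewrite -[e]invrK ltf_pV2 ?posrE ?invr_gt0 ?ltr0n //.
apply: lt_le_trans (truncnS_gt _) _.
by rewrite ler_nat.
Qed.

(* If [u 1 > t * u 0], log-convexity forces [u n >= r ^ n * u 0] with [r > t]. *)
Lemma logconvex_growth (R : realType) (u : nat -> R) (C t : R) :
  0 < t -> (forall n, 0 <= u n) ->
  (forall n, u n.+1 ^+ 2 <= u n * u n.+2) ->
  (forall n, u n <= C * t ^+ n) -> u 1%N <= t * u 0%N.
Proof.
move=> t0 u0 uc uC; rewrite leNgt; apply/negP => lt1.
have p0 : 0 < u 0%N.
  rewrite lt_neqAle u0 andbT; apply/eqP => z.
  have := uc 0%N; rewrite -z mul0r; move: lt1; rewrite -z mulr0 => h1.
  by have := exprn_gt0 2 h1; lra.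
set r := u 1%N / u 0%N.
have rt : t < r by rewrite ltr_pdivlMr.
have r0 : 0 < r by apply: lt_trans rt.
(* Log-convexity keeps every successive ratio at least the first one, [r]. *)
have step n : 0 < u n /\ r * u n <= u n.+1.
  elim: n => [|n [IH1 IH2]]; first by split=> //; rewrite divfK // gt_eqF.
  have p1 : 0 < u n.+1 by apply: lt_le_trans IH2; apply: mulr_gt0.
  split=> //; rewrite -(ler_pM2l IH1).
  apply: le_trans (uc n); rewrite expr2 mulrCA mulrA.
  by apply: ler_wpM2r => //; apply: ltW.
have pow n : r ^+ n * u 0%N <= u n.
  elim: n => [|n IH]; first by rewrite expr0 mul1r.
  apply: le_trans (proj2 (step n)); rewrite exprS -mulrA.
  by apply: ler_wpM2l => //; apply: ltW.
set d := r / t - 1.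
have d0 : 0 < d by rewrite subr_gt0 ltr_pdivlMr // mul1r.
(* Bernoulli's inequality: [(r / t) ^ n] outgrows the constant [C]. *)
have bern n : 1 + n%:R * d <= (r / t) ^+ n.
  elim: n => [|n IH]; first by rewrite mul0r addr0 expr0.
  have -> : r / t = 1 + d by rewrite /d; lra.
  rewrite exprS -natr1.
  have := IH; have -> : r / t = 1 + d by rewrite /d; lra.
  have n0 : 0 <= (n%:R : R) by apply: ler0n.
  nra.
have bd n : (1 + n%:R * d) * u 0%N <= C.
  have tn : 0 < t ^+ n by apply: exprn_gt0.
  rewrite -(ler_pM2r tn).
  apply: le_trans (uC n); apply: le_trans (pow n).
  rewrite mulrAC; apply: ler_wpM2r; first exact: ltW.
  have -> : r ^+ n = (r / t) ^+ n * t ^+ n by rewrite -exprMn divfK // gt_eqF.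
  by apply: ler_wpM2r; [exact: ltW | exact: bern].
have du : 0 < d * u 0%N by apply: mulr_gt0.
have C0 : 0 <= C by have := bd 0%N; rewrite mul0r addr0 mul1r; apply: le_trans; apply: ltW.
have := bd (Num.truncn (C / (d * u 0%N))).+1.
have := truncnS_gt (C / (d * u 0%N)).
set k := _.+1%:R; rewrite ltr_pdivrMr // => h1.
rewrite mulrDl mul1r -mulrA; lra.
Qed.

(** * The inner product and its norm *)

Section InnerProduct.
Variables (R : realType) (V : lmodType R[i]) (ip : V -> V -> R[i]).
Hypothesis Hip : is_inner_product ip.

Local Notation N := (qnorm ip).
Local Notation rp x y := (complex.Re (ip x y)).
Local Notation RtoC t := ((t%:C)%C).

Lemma ipZDl a x y z : ip (a *: x + y) z = a * ip x z + ip y z.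
Proof. by case: Hip. Qed.

Lemma ipC x y : ip x y = conjc (ip y x).
Proof. by case: Hip => _ -> _ _. Qed.

Lemma ipDl x y z : ip (x + y) z = ip x z + ip y z.
Proof. by rewrite -[x]scale1r ipZDl mul1r scale1r. Qed.

Lemma ip0l z : ip 0 z = 0.
Proof. by apply: (@addrI _ (ip 0 z)); rewrite -ipDl !addr0. Qed.

Lemma ipZl a x z : ip (a *: x) z = a * ip x z.
Proof. by rewrite -[a *: x]addr0 ipZDl ip0l addr0. Qed.

Lemma ipNl x z : ip (- x) z = - ip x z.
Proof. by rewrite -scaleN1r ipZl mulN1r. Qed.

Lemma ipBl x y z : ip (x - y) z = ip x z - ip y z.
Proof. by rewrite ipDl ipNl. Qed.

Lemma ipDr x y z : ip z (x + y) = ip z x + ip z y.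
Proof. by rewrite ipC ipDl rmorphD /= -!ipC. Qed.

Lemma ipZr a x z : ip z (a *: x) = conjc a * ip z x.
Proof. by rewrite ipC ipZl rmorphM /= -ipC. Qed.

Lemma ipNr x z : ip z (- x) = - ip z x.
Proof. by rewrite ipC ipNl rmorphN /= -ipC. Qed.

Lemma ipBr x y z : ip z (x - y) = ip z x - ip z y.
Proof. by rewrite ipDr ipNr. Qed.

Lemma rpDl x y z : rp (x + y) z = rp x z + rp y z.
Proof. by rewrite ipDl; case: (ip x z); case: (ip y z). Qed.

Lemma rpNl x z : rp (- x) z = - rp x z.
Proof. by rewrite ipNl; case: (ip x z). Qed.

Lemma rpBl x y z : rp (x - y) z = rp x z - rp y z.
Proof. by rewrite rpDl rpNl. Qed.

Lemma rpC x y : rp x y = rp y x.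
Proof. by rewrite ipC; case: (ip y x). Qed.

Lemma rpDr x y z : rp z (x + y) = rp z x + rp z y.
Proof. by rewrite !(rpC z) rpDl. Qed.

Lemma rpBr x y z : rp z (x - y) = rp z x - rp z y.
Proof. by rewrite !(rpC z) rpBl. Qed.

Lemma rpZl t x z : rp (RtoC t *: x) z = t * rp x z.
Proof. by rewrite ipZl; case: (ip x z) => a b /=; rewrite mul0r subr0. Qed.

Lemma rpZr t x z : rp z (RtoC t *: x) = t * rp z x.
Proof. by rewrite !(rpC z) rpZl. Qed.

Lemma rp_ge0 x : 0 <= rp x x.
Proof. by case: Hip => _ _ /(_ x); rewrite lecE => /andP[]. Qed.

Lemma qnorm_ge0 x : 0 <= N x.
Proof. exact: sqrtr_ge0. Qed.

Lemma qnorm_sqr x : N x ^+ 2 = rp x x.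
Proof. by rewrite sqr_sqrtr ?rp_ge0. Qed.

Lemma qnorm0 : N 0 = 0.
Proof. by rewrite /qnorm ip0l sqrtr0. Qed.

Lemma qnorm0_eq0 x : N x = 0 -> x = 0.
Proof.
move=> Nx; case: (Hip) => _ _ /(_ x) + H; move: (qnorm_sqr x) (H x).
rewrite Nx expr0n lecE /=.
by case: (ip x x) => a b /= <- h /andP[/eqP b0 _]; apply: h; rewrite b0.
Qed.

Lemma qnormN x : N (- x) = N x.
Proof. by rewrite /qnorm rpNl rpC rpNl opprK. Qed.

Lemma qnormBC x y : N (x - y) = N (y - x).
Proof. by rewrite -qnormN opprB. Qed.

Lemma qnormZ t x : N (RtoC t *: x) = `|t| * N x.
Proof.
by rewrite /qnorm rpZl rpZr mulrA -expr2 sqrtrM ?sqr_ge0 // sqrtr_sqr.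
Qed.

Lemma cauchy_schwarz x y : rp x y <= N x * N y.
Proof.
have [y0|y0] := eqVneq (N y) 0.
  by rewrite (qnorm0_eq0 y0) qnorm0 mulr0 rpC ip0l.
have Ny : 0 < N y by rewrite lt_neqAle eq_sym y0 qnorm_ge0.
have Nx := qnorm_ge0 x.
(* Expanding this square gives [2 * N x * N y * (N x * N y - rp x y) >= 0]. *)
have := rp_ge0 (RtoC (N y) *: x - RtoC (N x) *: y).
rewrite rpBl !rpBr !rpZl !rpZr -!qnorm_sqr (rpC y x) => h.
have h2 : 0 <= N x * N y * (N x * N y - rp x y) by nra.
have [x0|x0] := eqVneq (N x) 0.
  by rewrite (qnorm0_eq0 x0) qnorm0 mul0r ip0l.
have Nx' : 0 < N x by rewrite lt_neqAle eq_sym x0.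
by rewrite pmulr_rge0 ?mulr_gt0 // subr_ge0 in h2.
Qed.

Lemma ler_qnormD x y : N (x + y) <= N x + N y.
Proof.
rewrite -(@ler_pXn2r _ 2) ?nnegrE ?addr_ge0 ?qnorm_ge0 //.
rewrite qnorm_sqr rpDl !rpDr -!qnorm_sqr (rpC y x).
have := cauchy_schwarz x y; nra.
Qed.

Lemma ler_qnormB x y : N (x - y) <= N x + N y.
Proof. by rewrite -(qnormN y) ler_qnormD. Qed.

Lemma ler_qnorm_dist x y z : N (x - z) <= N (x - y) + N (y - z).
Proof. by have := ler_qnormD (x - y) (y - z); rewrite addrA subrK. Qed.

Lemma rp_iC x y : rp x ('i%C *: y) = complex.Im (ip x y).
Proof. by rewrite ipZr; case: (ip x y) => a b /=; rewrite mul0r sub0r mulN1r opprK. Qed.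

(** Carries adjoint identities to graph limits. Cauchy-Schwarz gives one inequality of real parts,
    exchanging roles the other, and multiplying [u] and [v] by [i] reaches the imaginary parts. *)
Lemma ip_eq_of_approx x y u v :
  (forall e, 0 < e -> exists x' y', [/\ N (x - x') < e, N (y - y') < e &
     ip y' u = ip x' v]) -> ip y u = ip x v.
Proof.
have key a b u' v' : (forall e, 0 < e -> exists a' b', [/\ N (a - a') < e,
    N (b - b') < e & rp b' u' = rp a' v']) -> rp b u' <= rp a v'.
  move=> H; apply: (@ler_of_eps _ _ _ (N u' + N v')) => e e0.
  have [a' [b' [ha hb E]]] := H e e0.
  have h1 := cauchy_schwarz (b - b') u'.
  have h2 := cauchy_schwarz (a' - a) v'.
  have nu := qnorm_ge0 u'; have nv := qnorm_ge0 v'.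
  move: h1 h2; rewrite (qnormBC a') !rpBl E; nra.
move=> H.
have E u' v' : (forall x' y', ip y' u = ip x' v -> rp y' u' = rp x' v') ->
    rp y u' = rp x v'.
  move=> H'; apply/eqP; rewrite eq_le; apply/andP.
  split; apply: key => e e0; have [x' [y' [? ? /H' ?]]] := H e e0.
    by exists x', y'.
  by exists y', x'.
have hr : rp y u = rp x v by apply: E => x' y' ->.
have hi : complex.Im (ip y u) = complex.Im (ip x v).
  by rewrite -!rp_iC; apply: E => x' y'; rewrite !rp_iC => ->.
by apply/eqP; rewrite eq_complex hr hi !eqxx.
Qed.

(** * Dense subspaces and orthogonality *)

Definition dense (W : V -> Prop) :=
  forall x e, 0 < e -> exists w, W w /\ N (x - w) < e.

(** Testing [x] against approximations of [x] itself gives [N x ^ 2 <= K * N x]. *)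
Lemma qnorm_le_of_dense W x K : dense W -> 0 <= K ->
  (forall w, W w -> rp w x <= K * N w) -> N x <= K.
Proof.
move=> dW K0 H; have nx := qnorm_ge0 x.
have : N x * N x <= K * N x.
  apply: (@ler_of_eps _ _ _ (K + N x)) => e e0.
  have [w [Ww hw]] := dW x e e0.
  have h1 := H w Ww; have h2 := cauchy_schwarz (x - w) x.
  have h3 : N w <= N x + e.
    have := ler_qnormB x (x - w); rewrite subKr => /le_trans; apply.
    by rewrite lerD2l ltW.
  have h4 : K * N w <= K * (N x + e) by apply: ler_wpM2l.
  have h5 : N (x - w) * N x <= e * N x by apply: ler_wpM2r => //; apply: ltW.
  move: h2; rewrite rpBl -qnorm_sqr expr2; lra.
have [-> //|x0] := eqVneq (N x) 0.
by rewrite ler_pM2r // lt_neqAle eq_sym x0.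
Qed.

(** Projection argument: a minimizing sequence in [W] is Cauchy, its limit [l] realizes the
    distance, and [x - l] is orthogonal to [W], hence zero. *)
Lemma dense_of_orthogonal (W : V -> Prop) : is_complete ip ->
  W 0 -> (forall a x y, W x -> W y -> W (a *: x + y)) ->
  (forall x, (forall w, W w -> ip w x = 0) -> x = 0) -> dense W.
Proof.
move=> Hc W0 WZD Wo x.
have WZ a u : W u -> W (a *: u) by move=> Wu; rewrite -[_ *: _]addr0; apply: WZD.
have WD u v : W u -> W v -> W (u + v).
  by move=> Wu Wv; rewrite -[u]scale1r; apply: WZD.
pose E : set R := [set N (x - w) | w in W]%classic.
have E0 : nonempty E by exists (N (x - 0)), 0.
have Elb : has_lbound E by exists 0 => _ [w _ <-]; apply: qnorm_ge0.
pose d := inf E.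
have dle w : W w -> d <= N (x - w) by move=> Ww; apply: ge_inf => //; exists w.
have d0 : 0 <= d by apply: lb_le_inf => // _ [w _ <-]; apply: qnorm_ge0.
have near n : exists w, W w /\ N (x - w) < d + n.+1%:R^-1.
  have n0 : 0 < (n.+1%:R : R)^-1 by rewrite invr_gt0 ltr0n.
  by have [_ [w Ww <-] hw] := inf_adherent n0 (conj E0 Elb); exists w.
have [w hw] := choice near.
(* Parallelogram law: the midpoint of [u] and [v] lies in [W], so at distance at least [d] from
   [x]. *)
have mid u v p q : W u -> W v -> N (x - u) < d + p -> N (x - v) < d + q ->
    0 < p -> 0 < q -> N (u - v) ^+ 2 <= 4 * d * (p + q) + 2 * (p ^+ 2 + q ^+ 2).
  move=> Wu Wv hu hv p0 q0.
  have dm := dle _ (WZ (RtoC 2^-1) _ (WD _ _ Wu Wv)).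
  have nu := qnorm_ge0 (x - u); have nv := qnorm_ge0 (x - v).
  have : N (x - u) ^+ 2 <= (d + p) ^+ 2 by apply: lerXn2r; rewrite ?nnegrE //; lra.
  have : N (x - v) ^+ 2 <= (d + q) ^+ 2 by apply: lerXn2r; rewrite ?nnegrE //; lra.
  have : d ^+ 2 <= N (x - RtoC 2^-1 *: (u + v)) ^+ 2.
    by apply: lerXn2r; rewrite ?nnegrE ?qnorm_ge0.
  rewrite !qnorm_sqr !rpBl !rpBr !(rpDl, rpDr, rpZl, rpZr).
  rewrite (rpC u x) (rpC v x) (rpC v u); lra.
have cauchy e : 0 < e -> exists k, forall m n, (k <= m)%N -> (k <= n)%N ->
    N (w m - w n) < e.
  move=> e0.
  (* For [p = q = h <= 1] the bound of [mid] is at most [h * (8 * d + 4)]; the 5 makes the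
     inequality strict. *)
  pose h := Num.min 1 (e ^+ 2 / (8 * d + 5)).
  have D0 : 0 < 8 * d + 5 by lra.
  have h0 : 0 < h by rewrite lt_min ltr01 divr_gt0 // exprn_gt0.
  have h1 : h <= 1 by rewrite ge_min lexx.
  have h2 : h * (8 * d + 5) <= e ^+ 2.
    by rewrite -ler_pdivlMr // ge_min lexx orbT.
  have [k hk] := archi_inv h0; exists k => m n km kn.
  have [Wm wm] := hw m; have [Wn wn] := hw n.
  have hm := hk m km; have hn := hk n kn.
  have am : N (x - w m) < d + h by apply: lt_trans wm _; rewrite ltrD2l.
  have an : N (x - w n) < d + h by apply: lt_trans wn _; rewrite ltrD2l.
  have hh := mid _ _ _ _ Wm Wn am an h0 h0.
  rewrite -(@ltr_pXn2r _ 2) ?nnegrE ?qnorm_ge0 ?(ltW e0) //.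
  apply: le_lt_trans hh _; apply: lt_le_trans h2; nra.
have [l hl] := Hc w cauchy.
have dl : N (x - l) <= d.
  apply: (@ler_of_eps _ _ _ 2) => e e0.
  have [k1 hk1] := archi_inv e0; have [k2 hk2] := hl e e0.
  pose n := maxn k1 k2.
  have [_ wn] := hw n.
  have a1 : N (x - w n) < d + e.
    by apply: lt_trans wn _; rewrite ltrD2l hk1 ?leq_maxl.
  have a2 := hk2 n (leq_maxr _ _).
  have := ler_qnorm_dist x (w n) l; lra.
have xl : x - l = 0.
  have far u : W u -> d <= N (x - l - u).
    move=> Wu; apply: (@ler_of_eps _ _ _ 1) => e e0; have [k hk] := hl e e0.
    have [Wk _] := hw k; have := hk k (leqnn k).
    have := dle _ (WD _ _ Wu Wk); have := ler_qnormB (x - l - u) (w k - l).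
    by rewrite opprB [x - l - u]addrAC addrA subrK opprD addrA; lra.
  (* Minimality is tested at [(r / m) u], where [m = N u ^ 2 + 1] is never zero; it yields
     [r ^ 2 / m <= 0]. *)
  have key u : W u -> rp u (x - l) = 0.
    move: (x - l) dl far => z dl far Wu; set r := rp u z; set m := N u ^+ 2 + 1.
    have m0 : 0 < m by have := sqr_ge0 (N u); rewrite /m; lra.
    have := far _ (WZ (RtoC (r / m)) _ Wu).
    have n0 := qnorm_ge0 z.
    rewrite -(@ler_pXn2r _ 2) ?nnegrE ?qnorm_ge0 // qnorm_sqr.
    rewrite rpBl !rpBr !rpZl !rpZr (rpC _ u) -/r -!qnorm_sqr => h.
    have h2 : N z ^+ 2 <= d ^+ 2 by apply: lerXn2r; rewrite ?nnegrE.
    have h3 : r / m * (r / m * N u ^+ 2) <= r / m * r.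
      have -> : N u ^+ 2 = m - 1 by rewrite /m addrK.
      rewrite mulrBr mulr1 divfK ?gt_eqF // mulrBr gerBl -expr2; exact: sqr_ge0.
    have h4 : r / m * r <= 0 by lra.
    apply/eqP; rewrite -sqrf_eq0 eq_le sqr_ge0 andbT.
    by move: h4; rewrite mulrAC ler_pdivrMr // mul0r expr2.
  apply: Wo => v Wv; apply/eqP; rewrite eq_complex key // eqxx /=.
  have := key _ (WZ 'i%C _ Wv); rewrite ipZl.
  by case: (ip v _) => p q /=; rewrite mul0r mul1r sub0r => /eqP; rewrite oppr_eq0.
move=> e e0; have [k hk] := hl e e0; exists (w k).
by have /eqP := xl; rewrite subr_eq0 => /eqP ->; rewrite qnormBC hk //; case: (hw k).
Qed.

(* The sequence [N (J (T^n x))] is log-convex by Cauchy-Schwarz. *)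
Lemma lax_bound (T J : V -> V) (t j : R) : 0 < t -> 0 <= j ->
  (forall x, N (T x) <= t * N x) -> (forall x, N (J x) <= j * N x) ->
  (forall x y, ip (J (T x)) (J y) = ip (J x) (J (T y))) ->
  forall x, N (J (T x)) <= t * N (J x).
Proof.
move=> t0 j0 bT bJ TJ x.
apply: (@logconvex_growth _ (fun n => N (J (iter n T x))) (j * N x) t) => // n.
- exact: qnorm_ge0.
- by rewrite qnorm_sqr /= TJ cauchy_schwarz.
- apply: le_trans (bJ _) _; rewrite -mulrA; apply: ler_wpM2l => //.
  elim: n => [|n IH]; first by rewrite expr0 mulr1.
  apply: le_trans (bT _) _; rewrite exprS mulrCA; apply: ler_wpM2l => //.
  exact: ltW.
Qed.

(** * Self-adjoint operators given by their graphs *)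

Section SelfAdjoint.
Variables (D : V -> Prop) (T : V -> V).
Hypothesis saT : self_adjoint (fun _ => True) ip (graph D T).

Lemma self_adjoint_sym x y : D x -> D y -> ip (T x) y = ip x (T y).
Proof.
by case: saT => _ /(_ y (T y)) [H _] Dx Dy; case: H => // _ [_]; apply.
Qed.

(** Maximality of the graph; this is how membership in a domain is obtained. *)
Lemma self_adjointP x y : (forall f, D f -> ip (T f) x = ip f y) ->
  D x /\ T x = y.
Proof.
case: saT => _ /(_ x y) [_ H] E; case: H => //.
by split=> //; split=> // f _ [Df ->]; apply: E.
Qed.

Lemma self_adjoint_linear a x y : D x -> D y ->
  D (a *: x + y) /\ T (a *: x + y) = a *: T x + T y.
Proof.
move=> Dx Dy; apply: self_adjointP => f Df.
by rewrite !ipDr !ipZr !self_adjoint_sym.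
Qed.

Lemma self_adjoint0 : D 0 /\ T 0 = 0.
Proof. by apply: self_adjointP => f Df; rewrite !(ipC _ 0) !ip0l. Qed.

(** If [x] is orthogonal to [D], then [(0, x)] lies in the adjoint, so [x = T 0 = 0]. *)
Lemma self_adjoint_dense : is_complete ip -> dense D.
Proof.
move=> Hc; apply: dense_of_orthogonal => //.
- by case: self_adjoint0.
- by move=> a x y Dx Dy; case: (self_adjoint_linear a Dx Dy).
move=> x H; have [_ <-] : D 0 /\ T 0 = x.
  by apply: self_adjointP => f Df; rewrite H // ipC ip0l /= oppr0.
by case: self_adjoint0.
Qed.

Lemma self_adjointB x y : D x -> D y -> D (x - y) /\ T (x - y) = T x - T y.
Proof.
by move=> Dx Dy; have := self_adjoint_linear (-1) Dy Dx; rewrite !scaleN1r ![- _ + _]addrC.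
Qed.

End SelfAdjoint.
End InnerProduct.

(** * The energy space, the square root of [B] and its inverse *)

Section EnergySpace.
Variables (R : realType) (V : lmodType R[i]) (ip : V -> V -> R[i]).
Hypotheses (Hip : is_inner_product ip) (Hcompl : is_complete ip).
Variables (DA : V -> Prop) (A : V -> V).
Hypothesis saA : self_adjoint (fun _ => True) ip (graph DA A).
Variables (DS : V -> Prop) (S : V -> V).
Hypothesis saS : self_adjoint (fun _ => True) ip (graph DS S).
Variables (Sinv Binv : V -> V).
Hypothesis SinvK : forall g, DS (Sinv g) /\ S (Sinv g) = g.
Hypothesis SK : forall f, DS f -> Sinv (S f) = f.
Hypothesis BinvE : forall g, Binv g = Sinv (Sinv g).
Variable c0 : R.
Hypothesis Binv_bounded : forall g, qnorm ip (Binv g) <= c0 * qnorm ip g.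

Local Notation N := (qnorm ip).
Local Notation rp x y := (complex.Re (ip x y)).
Local Notation qB := (fun f g => ip (S f) (S g)).
Local Notation core := (fun f => DA f /\ DS f).
Local Notation L0 := (graph core (fun f => Binv (A f))).
Local Notation L := (rel_closure DS qB L0).

Definition energy_dense (W : V -> Prop) :=
  forall f, DS f -> forall e : R, 0 < e ->
    exists g, W g /\ DS g /\ N (S (f - g)) < e.

Lemma energy_qnormE f : qnorm qB f = N (S f). Proof. by []. Qed.

Lemma dom_Sinv g : DS (Sinv g). Proof. by case: (SinvK g). Qed.
Lemma S_Sinv g : S (Sinv g) = g. Proof. by case: (SinvK g). Qed.

Lemma SB x y : DS x -> DS y -> S (x - y) = S x - S y.
Proof. by move=> Dx Dy; case: (self_adjointB Hip saS Dx Dy). Qed.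

Lemma dom_SB x y : DS x -> DS y -> DS (x - y).
Proof. by move=> Dx Dy; case: (self_adjointB Hip saS Dx Dy). Qed.

Lemma Sinv_linear a x y : Sinv (a *: x + y) = a *: Sinv x + Sinv y.
Proof.
have [D E] := self_adjoint_linear Hip saS a (dom_Sinv x) (dom_Sinv y).
by rewrite -{1}(S_Sinv x) -{1}(S_Sinv y) -E SK.
Qed.

Lemma SinvB x y : Sinv (x - y) = Sinv x - Sinv y.
Proof. by rewrite addrC -scaleN1r Sinv_linear scaleN1r addrC. Qed.

Lemma Sinv_sym x y : ip (Sinv x) y = ip x (Sinv y).
Proof.
rewrite -{1}(S_Sinv y) -(self_adjoint_sym saS) ?S_Sinv //; exact: dom_Sinv.
Qed.

Lemma S_Binv g : S (Binv g) = Sinv g.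
Proof. by rewrite BinvE S_Sinv. Qed.

Lemma dom_Binv g : DS (Binv g).
Proof. by rewrite BinvE; apply: dom_Sinv. Qed.

(** A bound for [Sinv] that avoids a square root: being at least 1, its square dominates [c0]. *)
Definition Sinv_bound := `|c0| + 1.

Lemma Sinv_bound_gt0 : 0 < Sinv_bound.
Proof. by rewrite ltr_wpDl. Qed.

(** By symmetry [N (Sinv x) ^ 2] equals [<Binv x, x>], at most [c0 * N x ^ 2]. *)
Lemma Sinv_bounded x : N (Sinv x) <= Sinv_bound * N x.
Proof.
have s1 : 1 <= Sinv_bound by rewrite lerDr.
have cs : c0 <= Sinv_bound by apply: le_trans (ler_norm c0) _; rewrite lerDl.
have nx := qnorm_ge0 ip x.
rewrite -(@ler_pXn2r _ 2) ?nnegrE ?mulr_ge0 ?qnorm_ge0 ?(ltW Sinv_bound_gt0) //.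
rewrite qnorm_sqr // Sinv_sym -BinvE rpC //.
apply: le_trans (cauchy_schwarz Hip _ _) _.
apply: le_trans (ler_wpM2r nx (Binv_bounded x)) _.
rewrite -mulrA -expr2 exprMn; apply: ler_wpM2r; first exact: sqr_ge0.
by rewrite expr2; nra.
Qed.

Lemma qnorm_le_energy f : DS f -> N f <= Sinv_bound * N (S f).
Proof. by move=> Df; rewrite -{1}(SK Df) Sinv_bounded. Qed.

Lemma pairing_Sinv f h : DS h -> ip (Sinv f) (S h) = ip f h.
Proof. by move=> Dh; rewrite Sinv_sym SK. Qed.

(** * Adjoint and closure of the core operator *)

Lemma adjointP h k : rel_adjoint DS qB L0 h k <->
  [/\ DS h, DS k & forall f, DA f -> DS f -> ip (A f) h = ip (S f) (S k)].
Proof.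
split=> [[Dh [Dk E]]|[Dh Dk E]].
  split=> // f Af Sf; have /= <- := E f _ (conj (conj Af Sf) erefl).
  by rewrite S_Binv pairing_Sinv.
by split=> //; split=> // f g [[Af Sf] ->]; rewrite S_Binv pairing_Sinv //; apply: E.
Qed.

Lemma S_dense W : energy_dense W -> dense ip (fun x => exists2 f, W f & x = S f).
Proof.
move=> dW x e e0; have [g [Wg [Dg hg]]] := dW _ (dom_Sinv x) e e0.
exists (S g); split; first by exists g.
by move: hg; rewrite SB ?S_Sinv //; apply: dom_Sinv.
Qed.

Lemma closure_adjoint h k f g : rel_adjoint DS qB L0 h k -> L f g ->
  qB g h = qB f k.
Proof.
move=> [Dh [Dk E]] [Df [Dg H]]; apply: ip_eq_of_approx => // e e0.
have [f' [g' [G [hf hg]]]] := H e e0; have Eq := E _ _ G.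
case: G => [[_ Df'] Eg']; have Dg' : DS g' by rewrite Eg'; apply: dom_Binv.
by exists (S f'), (S g'); rewrite -!SB.
Qed.

Lemma core_symmetric f g : L0 f g -> rel_adjoint DS qB L0 f g.
Proof.
move=> [[Af Sf] ->]; apply/adjointP; split=> // [|f' Af' Sf']; first exact: dom_Binv.
by rewrite S_Binv -Sinv_sym SK // (self_adjoint_sym saA).
Qed.

(** The limit argument is used once in each variable: to place [(h, k)] in the adjoint of the core
    operator, and to replace core pairs by pairs of the closure. *)
Lemma closure_symmetric h k : L h k -> rel_adjoint DS qB L h k.
Proof.
move=> Lhk; have [Dh [Dk _]] := Lhk; split=> //; split=> // f g Lfg.
suff adj : rel_adjoint DS qB L0 h k by apply: closure_adjoint.
split=> //; split=> // f' g' /core_symmetric adj.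
have := closure_adjoint adj Lhk => E.
by rewrite ipC // -E -ipC.
Qed.

Lemma core_sub_closure f g : L0 f g -> L f g.
Proof.
move=> G; case: (G) => [[Af Df] Eg]; split=> //.
split; first by rewrite Eg; apply: dom_Binv.
move=> e e0; exists f, g.
have [_ S0] := self_adjoint0 Hip saS.
by rewrite !subrr !energy_qnormE S0 qnorm0.
Qed.

(** [S (k - k')] is orthogonal to the image of the core under [S], which is dense. *)
Lemma adjoint_unique h k k' : energy_dense core ->
  rel_adjoint DS qB L0 h k -> rel_adjoint DS qB L0 h k' -> k = k'.
Proof.
move=> dD /adjointP[Dh Dk E] /adjointP[_ Dk' E'].
suff Nz : N (S (k - k')) <= 0.
  have /(qnorm0_eq0 Hip) : N (S (k - k')) = 0.
    by apply/eqP; rewrite eq_le Nz qnorm_ge0.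
  move=> Sz; rewrite -(SK Dk) -(SK Dk').
  by move: Sz; rewrite SB // => /eqP; rewrite subr_eq0 => /eqP ->.
apply: (qnorm_le_of_dense Hip (S_dense dD)) => // _ [f [Af Sf] ->].
by rewrite mul0r SB // rpBr // -E // -E' // subrr.
Qed.

(** The closure is symmetric and extends the core operator, so its adjoint lies in that of the core
    operator; only the assumed inclusion is missing. *)
Lemma closure_self_adjoint : energy_dense core ->
  (forall h k, rel_adjoint DS qB L0 h k -> L h k) -> self_adjoint DS qB L.
Proof.
move=> dD H.
have sub h k : rel_adjoint DS qB L h k -> rel_adjoint DS qB L0 h k.
  by move=> [Dh [Dk E]]; split=> //; split=> // f g /core_sub_closure; apply: E.
split.
  move=> f g g' /closure_symmetric/sub Lg /closure_symmetric/sub.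
  exact: adjoint_unique dD Lg.
move=> f g; split; first exact: closure_symmetric.
by move=> /sub/H.
Qed.

(** Any [f'] in [W] near [h] works: for [f] in [W], [<S f, S k - Sinv (A f')>] equals
    [<Sinv (A f), S (h - f')>], which the bound controls, and such [S f] are dense. *)
Lemma adjoint_sub_closure_bounded (W : V -> Prop) (c : R) :
  (forall f, W f -> DA f /\ DS f) -> energy_dense W -> 0 <= c ->
  (forall f, W f -> N (Sinv (A f)) <= c * N (S f)) ->
  forall h k, rel_adjoint DS qB L0 h k -> L h k.
Proof.
move=> sW dW cge bW h k /adjointP[Dh Dk E]; split=> //; split=> // e e0.
have c1 : 0 < c + 1 by rewrite ltr_wpDl.
(* With [c + 1], one choice of [f'] makes both [N (S (h - f'))] and [c] times it smaller than
   [e]. *)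
have e1 : 0 < e / (c + 1) by rewrite divr_gt0.
have [f' [Wf' [Df' hf']]] := dW _ Dh _ e1.
have [Af' _] := sW _ Wf'.
have hc : (c + 1) * N (S (h - f')) < e by rewrite mulrC -ltr_pdivlMr.
have n0 := qnorm_ge0 ip (S (h - f')).
exists f', (Binv (A f')); split=> //; split.
  by rewrite energy_qnormE; nra.
rewrite !energy_qnormE SB //; last exact: dom_Binv.
rewrite S_Binv; apply: le_lt_trans (_ : c * N (S (h - f')) < e); last by nra.
apply: (qnorm_le_of_dense Hip (S_dense dW)) => [|_ [f Wf ->]].
  by apply: mulr_ge0.
have [Af Sf] := sW _ Wf.
have -> : ip (S f) (S k - Sinv (A f')) = ip (Sinv (A f)) (S (h - f')).
  rewrite ipBr // -E // -Sinv_sym SK // -(self_adjoint_sym saA) // -ipBr //.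
  by rewrite pairing_Sinv //; apply: dom_SB.
apply: le_trans (cauchy_schwarz Hip _ _) _.
rewrite mulrAC; apply: ler_wpM2r => //; exact: bW.
Qed.

(** Extension by continuity: the bound makes the images of a sequence tending to [f] Cauchy in
    energy norm. *)
Lemma closure_bounded (c : R) : energy_dense core -> 0 <= c ->
  (forall f, DA f -> DS f -> N (Sinv (A f)) <= c * N (S f)) ->
  bounded_everywhere DS qB L.
Proof.
move=> dD cge bD; have c1 : 0 < c + 1 by rewrite ltr_wpDl.
have bd f f' : core f -> core f' ->
    N (Sinv (A f) - Sinv (A f')) <= c * N (S f - S f').
  move=> [Af Sf] [Af' Sf']; have [AB EA] := self_adjointB Hip saA Af Af'.
  by rewrite -SinvB -EA -SB // bD //; apply: dom_SB.
split=> [f Df|].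
  have near n : exists g, core g /\ N (S f - S g) < n.+1%:R^-1.
    have n0 : 0 < (n.+1%:R : R)^-1 by rewrite invr_gt0 ltr0n.
    have [g [[Ag Sg] [_ hg]]] := dD _ Df _ n0.
    by exists g; split=> //; rewrite -SB.
  have [u hu] := choice near.
  have close e : 0 < e -> exists k, forall n, (k <= n)%N -> N (S f - S (u n)) < e.
    move=> e0; have [k hk] := archi_inv e0; exists k => n kn.
    by have [_ h] := hu n; apply: lt_trans h (hk n kn).
  have cauchy e : 0 < e -> exists k, forall m n, (k <= m)%N -> (k <= n)%N ->
      N (Sinv (A (u m)) - Sinv (A (u n))) < e.
    move=> e0; have e1 : 0 < e / (c + 1) / 2 by rewrite !divr_gt0.
    have [k hk] := close _ e1; exists k => m n km kn.
    have [Cm _] := hu m; have [Cn _] := hu n.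
    apply: le_lt_trans (bd _ _ Cm Cn) _.
    have a1 := hk m km; have a2 := hk n kn.
    have a3 := ler_qnorm_dist Hip (S (u m)) (S f) (S (u n)).
    have a4 := qnorm_ge0 ip (S (u m) - S (u n)).
    rewrite (qnormBC Hip (S (u m)) (S f)) in a3.
    have : N (S (u m) - S (u n)) < e / (c + 1) by lra.
    rewrite ltr_pdivlMr //; nra.
  have [y hy] := Hcompl cauchy.
  (* [y] is the limit of [S] applied to the images, so the value at [f] is [Sinv y]. *)
  exists (Sinv y); split=> //; split; first exact: dom_Sinv.
  move=> e e0; have [k1 h1] := close _ e0; have [k2 h2] := hy _ e0.
  pose n := maxn k1 k2; have [[An Sn] _] := hu n.
  exists (u n), (Binv (A (u n))); split=> //.
  rewrite !energy_qnormE.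
  rewrite !SB ?S_Binv ?S_Sinv //; [|exact: dom_Sinv|exact: dom_Binv].
  by rewrite h1 ?leq_maxl // qnormBC // h2 ?leq_maxr.
exists c => f g [Df [Dg H]]; rewrite !energy_qnormE.
apply: (@ler_of_eps _ _ _ (1 + c)) => e e0.
have [f' [g' [[[Af' Sf'] ->] [hf hg]]]] := H e e0.
move: hf hg; rewrite !energy_qnormE.
rewrite !SB ?S_Binv //; last exact: dom_Binv.
move=> hf hg; have := bD _ Af' Sf'.
have := ler_qnorm_dist Hip (S g) (Sinv (A f')) 0.
have := ler_qnorm_dist Hip (S f') (S f) 0; rewrite !subr0 (qnormBC Hip (S f')).
move=> h1 h2 h3; have : c * N (S f') <= c * (N (S f) + e).
  by apply: ler_wpM2l => //; lra.
lra.
Qed.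

(** * Bounds relative to [B], carried to the energy norm *)

Variables (DB : V -> Prop) (B : V -> V).
Hypothesis BinvK : forall g, DB (Binv g) /\ B (Binv g) = g.
Hypothesis BK : forall f, DB f -> Binv (B f) = f.
Hypothesis domB : forall f, DB f <-> DS f /\ DS (S f).

(** For [y] in [DS] near [S f], the vector [Sinv y] lies in [DB] and is near [f] in energy norm. *)
Lemma dom_B_energy_dense : energy_dense DB.
Proof.
move=> f Df e e0; have [y [Dy hy]] := self_adjoint_dense Hip saS Hcompl (S f) e0.
have Dg := dom_Sinv y.
exists (Sinv y); split; first by apply/domB; rewrite S_Sinv.
by split=> //; rewrite SB // S_Sinv.
Qed.

(** Lax's lemma for [A Binv] with [J = Sinv], evaluated at [B f]; since [<Sinv (A (Binv x)), Sinv y>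
    = <A (Binv x), Binv y>], its symmetry is that of [A]. *)
Lemma relatively_bounded_energy (t : R) : 0 < t ->
  (forall f, DB f -> DA f) -> (forall x, N (A (Binv x)) <= t * N x) ->
  forall f, DB f -> N (Sinv (A f)) <= t * N (S f).
Proof.
move=> t0 DBA bT f Df.
have dom x : DA (Binv x) by apply: DBA; case: (BinvK x).
have := lax_bound Hip t0 (ltW Sinv_bound_gt0) bT Sinv_bounded.
move=> /(_ _ (B f)) /=; rewrite (BK Df) -(S_Binv (B f)) (BK Df); apply=> x y.
by rewrite Sinv_sym -BinvE (self_adjoint_sym saA) // -[RHS]Sinv_sym -BinvE.
Qed.

(** * The resolvent of [A] at a real point *)

Variables (lam : R) (Res : V -> V).
Hypothesis ResK : forall g, DA (Res g) /\ A (Res g) - (lam%:C)%C *: Res g = g.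
Hypothesis DAB : forall f, DA f -> DB f.

Lemma resolvent_sym x y : ip (Res x) y = ip x (Res y).
Proof.
have [Dx Ex] := ResK x; have [Dy Ey] := ResK y.
rewrite -{1}Ey -{2}Ex ipBr // ipBl // (self_adjoint_sym saA) // ipZr // ipZl //.
by rewrite conjc_real.
Qed.

Lemma resolvent_dom x : DS (Res x) /\ DS (S (Res x)).
Proof. by apply/domB/DAB; case: (ResK x). Qed.

Hypothesis Ssq : forall f, DB f -> S (S f) = B f.

(** Lax's lemma for [B Res] with [J = Sinv]: here [Sinv (B (Res x)) = S (Res x)], and
    [<S (Res x), Sinv y> = <Res x, y>] is symmetric because [lam] is real. *)
Lemma resolvent_energy (t : R) : 0 < t ->
  (forall x, N (B (Res x)) <= t * N x) ->
  forall x, N (S (Res x)) <= t * N (Sinv x).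
Proof.
move=> t0 bT x; have DBR y : DB (Res y) by apply: DAB; case: (ResK y).
have SBE y : Sinv (B (Res y)) = S (Res y).
  by rewrite -Ssq // SK //; case: (resolvent_dom y).
rewrite -SBE; apply: (lax_bound Hip t0 (ltW Sinv_bound_gt0) bT Sinv_bounded).
move=> {}x y; have [Dx _] := resolvent_dom x; have [Dy _] := resolvent_dom y.
by rewrite !SBE pairing_Sinv // -Sinv_sym SK // resolvent_sym.
Qed.

(** Formally [S h = S (Res (S z))] for [z = S k - lam Sinv h]. A nearby [x] in [DS] replaces [z] and
    gives the candidate [f' = Res (S x)]; both errors are bounded by multiples of [N (z - x)]. *)
Lemma adjoint_sub_closure_resolvent (t : R) : 0 < t ->
  (forall x, N (S (Res x)) <= t * N (Sinv x)) ->
  forall h k, rel_adjoint DS qB L0 h k -> L h k.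
Proof.
move=> t0 bR h k /adjointP[Dh Dk E]; split=> //; split=> // e e0.
have [z Ez] : {z | z = S k - (lam%:C)%C *: Sinv h} by eexists.
(* The coefficients of [N (z - x)] in the estimates of [z - x], [S h - S f'] and
   [lam Sinv (h - f')]. *)
pose m := 1 + t + `|lam| * (Sinv_bound * (Sinv_bound * t)).
have m0 : 0 < m.
  apply: ltr_wpDr; last by rewrite addr_gt0.
  by rewrite !mulr_ge0 ?normr_ge0 ?(ltW Sinv_bound_gt0) ?ltW.
have e1 : 0 < e / m by rewrite divr_gt0.
have [x [Dx hx]] := self_adjoint_dense Hip saS Hcompl z e1.
pose f' := Res (S x).
have [Af' Ef'] := ResK (S x); have [Sf' _] := resolvent_dom (S x).
(* Substituting [g = (A - lam) (Res g)] turns the relation between [h] and [k] into one between [h]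
   and [z]. *)
have weak g : ip g h = ip (S (Res g)) z.
  have [Ag Eg] := ResK g; have [Sg _] := resolvent_dom g.
  rewrite Ez ipBr // -E // -{1}Eg ipBl // ipZl // ipZr // conjc_real.
  by rewrite -Sinv_sym SK.
have sf : N (S h - S f') <= t * N (z - x).
  apply: (qnorm_le_of_dense Hip (self_adjoint_dense Hip saS Hcompl)) => [|y Dy].
    by apply: mulr_ge0; rewrite ?qnorm_ge0 // ltW.
  have -> : ip y (S h - S f') = ip (S (Res (S y))) (z - x).
    rewrite !ipBr // -!(self_adjoint_sym saS) // weak; congr (_ - _).
    rewrite -resolvent_sym (self_adjoint_sym saS) //.
    by case: (resolvent_dom (S y)).
  apply: le_trans (cauchy_schwarz Hip _ _) _.
  rewrite mulrAC; apply: ler_wpM2r; first exact: qnorm_ge0.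
  by have := bR (S y); rewrite SK.
have nz := qnorm_ge0 ip (z - x).
have hm : m * N (z - x) < e by rewrite mulrC -ltr_pdivlMr.
exists f', (Binv (A f')); split=> //.
rewrite !energy_qnormE.
rewrite !SB ?S_Binv //; last exact: dom_Binv.
have -> : S k - Sinv (A f') = (z - x) + (lam%:C)%C *: Sinv (h - f').
  have -> : A f' = (lam%:C)%C *: f' + S x by rewrite -Ef' addrC subrK.
  rewrite Sinv_linear SK // SinvB scalerBr Ez opprD addrA [RHS]addrA.
  by rewrite addrAC [X in _ = X - _]addrAC subrK addrAC.
have sh : N (h - f') <= Sinv_bound * (t * N (z - x)).
  apply: le_trans (qnorm_le_energy (dom_SB Dh Sf')) _; rewrite SB //.
  by apply: ler_wpM2l => //; apply: ltW Sinv_bound_gt0.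
have sl : `|lam| * N (Sinv (h - f')) <= `|lam| * (Sinv_bound * (Sinv_bound * t)) * N (z - x).
  rewrite -[leRHS]mulrA; apply: ler_wpM2l => //.
  apply: le_trans (Sinv_bounded _) _; rewrite -!mulrA.
  by apply: ler_wpM2l => //; apply: ltW Sinv_bound_gt0.
have tz : 0 <= t * N (z - x) by rewrite mulr_ge0 // ltW.
have lz : 0 <= `|lam| * (Sinv_bound * (Sinv_bound * t)) * N (z - x).
  by apply: le_trans sl; rewrite mulr_ge0 ?qnorm_ge0.
rewrite /m in hm; split; first lra.
apply: le_lt_trans (ler_qnormD Hip _ _) _; rewrite qnormZ //; lra.
Qed.
End EnergySpace.

(** * The three conditions reduced to the inclusion of the adjoint in the closure *)

Theorem theorem1
  (R : realType) (V : lmodType R[i]) (ip : V -> V -> R[i])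
  (Hip : is_inner_product ip) (Hcompl : is_complete ip) (Hsep : is_separable ip)
  (* A : self-adjoint operator with domain DA *)
  (DA : V -> Prop) (A : V -> V)
  (HA : self_adjoint (fun _ => True) ip (graph DA A))
  (* B : self-adjoint, strictly positive, with bounded inverse Binv *)
  (DB : V -> Prop) (B : V -> V)
  (HB : self_adjoint (fun _ => True) ip (graph DB B))
  (HBpos : forall f, DB f -> f <> 0 -> 0 < ip (B f) f)
  (Binv : V -> V)
  (HBinv1 : forall g, DB (Binv g) /\ B (Binv g) = g)
  (HBinv2 : forall f, DB f -> Binv (B f) = f)
  (HBinvb : exists c : R, forall g, qnorm ip (Binv g) <= c * qnorm ip g)
  (* S = B^{1/2}: the positive self-adjoint square root of B *)
  (DS : V -> Prop) (S : V -> V)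
  (HS : self_adjoint (fun _ => True) ip (graph DS S))
  (HSpos : forall f, DS f -> 0 <= ip (S f) f)
  (HSdom : forall f, DB f <-> (DS f /\ DS (S f)))
  (HSsq : forall f, DB f -> S (S f) = B f)
  (* Sinv = B^{-1/2}: the (everywhere defined) inverse of B^{1/2} *)
  (Sinv : V -> V)
  (HSinv1 : forall g, DS (Sinv g) /\ S (Sinv g) = g)
  (HSinv2 : forall f, DS f -> Sinv (S f) = f)
  (* standing assumption (i): D(A) ∩ D(B^{1/2}) is dense in H_B *)
  (Hdense : forall f, DS f -> forall e : R, 0 < e ->
      exists g, DA g /\ DS g /\ qnorm ip (S (f - g)) < e)
  (* standing assumption (ii): A : D(A) ∩ D(B^{1/2}) ⊂ H_B -> H_{B^{-1}} closable *)
  (Hclos : forall u : nat -> V,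
      (forall n, DA (u n) /\ DS (u n)) ->
      (forall e : R, 0 < e -> exists N, forall n, (N <= n)%N -> qnorm ip (S (u n)) < e) ->
      (forall e : R, 0 < e -> exists N, forall m n, (N <= m)%N -> (N <= n)%N ->
          qnorm ip (Sinv (A (u m) - A (u n))) < e) ->
      forall e : R, 0 < e -> exists N, forall n, (N <= n)%N ->
          qnorm ip (Sinv (A (u n))) < e) :
  let qB := fun f g => ip (S f) (S g) in
  let L := rel_closure DS qB (graph (fun f => DA f /\ DS f) (fun f => Binv (A f))) in
  let C1 := exists a b : R, 0 < a /\ 0 < b /\ forall f, DA f -> DS f ->
      qnorm ip (Sinv (A f)) <= a * qnorm ip f + b * qnorm ip (S f) in
  let C2 := (forall f, DB f -> DA f) /\ exists a b : R, 0 < a /\ 0 < b /\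
      forall f, DB f -> qnorm ip (A f) <= a * qnorm ip f + b * qnorm ip (B f) in
  let C3 := (exists (lam : R) (Res : V -> V),
                (forall g, DA (Res g) /\ A (Res g) - (lam%:C)%C *: Res g = g) /\
                (forall f, DA f -> Res (A f - (lam%:C)%C *: f) = f) /\
                (exists c : R, forall g, qnorm ip (Res g) <= c * qnorm ip g)) /\
      (forall f, DA f -> DB f) /\ exists a b : R, 0 < a /\ 0 < b /\
      forall f, DA f -> qnorm ip (B f) <= a * qnorm ip f + b * qnorm ip (A f) in
  C1 \/ C2 \/ C3 ->
  self_adjoint DS qB L /\ (C1 -> bounded_everywhere DS qB L).
Proof.
move=> qB L C1 C2 C3.
have BinvE g : Binv g = Sinv (Sinv g).
  have [/HSdom[D1 D2] E] := HBinv1 g.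
  by rewrite -{2}E -HSsq ?HSinv2 //; apply/HSdom.
have [c0 Binvb] := HBinvb.
have Sinv_bound_gt0 := Sinv_bound_gt0 c0.
have C1_bound : C1 -> exists2 c, 0 <= c & forall f, DA f -> DS f ->
    qnorm ip (Sinv (A f)) <= c * qnorm ip (S f).
  (* [N f] is absorbed through [N f <= Sinv_bound c0 * N (S f)]. *)
  move=> [a [b [a0 [b0 H]]]]; exists (a * Sinv_bound c0 + b).
    by rewrite addr_ge0 ?mulr_ge0 // ltW.
  move=> f Af Sf; apply: le_trans (H f Af Sf) _.
  rewrite mulrDl lerD2r -mulrA; apply: ler_wpM2l; first exact: ltW.
  exact: (qnorm_le_energy Hip HS HSinv1 HSinv2 BinvE Binvb).
have core_dense : energy_dense ip DS S (fun f => DA f /\ DS f).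
  by move=> f Df e e0; have [g [Ag [Sg hg]]] := Hdense f Df e e0; exists g.
move=> C123; split; last first.
  move=> /C1_bound[c c_ge0 H].
  exact: (closure_bounded Hip Hcompl HA HS HSinv1 HSinv2 BinvE core_dense c_ge0).
apply: (closure_self_adjoint Hip HA HS HSinv1 HSinv2 BinvE core_dense).
have bounded_case := adjoint_sub_closure_bounded Hip HA HS HSinv1 HSinv2 BinvE.
have c0_le : c0 <= Sinv_bound c0 by rewrite (le_trans (ler_norm _)) // lerDl.
case: C123 => [/C1_bound[c c_ge0 H]|[]].
- by apply: (bounded_case _ c _ core_dense) => // f [Af Sf]; apply: H.
- move=> [DBA [a [b [a0 [b0 H]]]]].
  (* This constant bounds [A Binv] on the whole space, [Sinv_bound c0] serving as a positive
     majorant of [c0]. *)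
  have t0 : 0 < a * Sinv_bound c0 + b by rewrite addr_gt0 ?mulr_gt0.
  apply: (bounded_case DB _ _ _ (ltW t0)) => [f Df||].
  + by split; [apply: DBA | case/HSdom: Df].
  + exact: (dom_B_energy_dense Hip Hcompl HS HSinv1 HSdom).
  apply: (relatively_bounded_energy Hip HA HS HSinv1 BinvE Binvb HBinv1 HBinv2 t0) => // x.
  have [Dx Ex] := HBinv1 x; have := H _ Dx; rewrite Ex => /le_trans; apply.
  rewrite mulrDl lerD2r -mulrA; apply: ler_wpM2l; first exact: ltW.
  apply: le_trans (Binvb x) _; apply: ler_wpM2r => //; exact: qnorm_ge0.
move=> [[lam [Res [ResK [_ [c Resb]]]]] [DAB [a [b [a0 [b0 H]]]]]].
(* A bound for [B Res], from [A (Res x) = x + lam Res x] and [N (Res x) <= (|c| + 1) * N x]. *)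
pose t := (a + b * `|lam|) * (`|c| + 1) + b.
have d0 : 0 <= a + b * `|lam| by rewrite addr_ge0 ?mulr_ge0 // ltW.
have t0 : 0 < t by rewrite ltr_wpDl // mulr_ge0 // addr_ge0.
apply: (adjoint_sub_closure_resolvent Hip Hcompl HA HS HSinv1 HSinv2 BinvE Binvb
  HSdom ResK DAB t0).
apply: (resolvent_energy Hip HA HS HSinv1 HSinv2 BinvE Binvb HSdom ResK DAB
  HSsq t0) => x.
have [Ax Ex] := ResK x; apply: le_trans (H _ Ax) _.
have nx := qnorm_ge0 ip x.
have AR : qnorm ip (A (Res x)) <= qnorm ip x + `|lam| * qnorm ip (Res x).
  rewrite -(qnormZ Hip) -{1}(subrK ((lam%:C)%C *: Res x) (A (Res x))) Ex.
  exact: ler_qnormD.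
have RR : qnorm ip (Res x) <= (`|c| + 1) * qnorm ip x.
  apply: le_trans (Resb x) _; apply: ler_wpM2r => //.
  by rewrite (le_trans (ler_norm _)) // lerDl.
have bAR : b * qnorm ip (A (Res x)) <= b * (qnorm ip x + `|lam| * qnorm ip (Res x)).
  by apply: ler_wpM2l => //; apply: ltW.
have dRR : (a + b * `|lam|) * qnorm ip (Res x) <=
    (a + b * `|lam|) * ((`|c| + 1) * qnorm ip x).
  exact: ler_wpM2l.
rewrite /t; lra.
Qed.
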